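(* Let $M$ be a left module over a truss $(T,[-,-,-],\cdot)$, with action $(x,m)\mapsto x\triangleright m$. Then, for all $e\in M$, $M$ is a left $T$-module with the induced action $$T\times M\to M,\qquad (x,m)\mapsto x\triangleright^e m=[e,x\triangleright e,x\triangleright m]=[x\triangleright m,x\triangleright e,e].$$ For different choices of $e$ the induced modules are isomorphic. The induced module $(M,\triangleright^e)$ has an absorber $e$.
   Context: A heap is a non-empty set $H$ with a ternary operation $[-,-,-]$ satisfying $[v,w,[x,y,z]]=[[v,w,x],y,z]$ and $[x,x,y]=y=[y,x,x]$; it is Abelian if $[x,y,z]=[z,y,x]$. A heap morphism is a function preserving the ternary operations. A truss is an Abelian heap $T$ with an associative binary operation (juxtaposition) satisfying $w[x,y,z]=[wx,wy,wz]$ and $[x,y,z]w=[xw,yw,zw]$. A left $T$-module is an Abelian heap $M$ with a map $T\times M\to M$, $(x,m)\mapsto x\triangleright m$, such that $(xy)\triangleright m=x\triangleright(y\triangleright m)$, $x\triangleright[m,m',m'']=[x\triangleright m,x\triangleright m',x\triangleright m'']$ and $[x,y,z]\triangleright m=[x\triangleright m,y\triangleright m,z\triangleright m]$. A morphism of left $T$-modules is a heap morphism commuting with the actions; an isomorphism is a bijective morphism. An absorber in a left $T$-module is an element $a$ with $x\triangleright a=a$ for all $x\in T$. *)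

(* Defs.v *)
From HB Require Import structures.
From mathcomp Require Import all_boot.

Set Implicit Arguments.
Unset Strict Implicit.
Unset Printing Implicit Defensive.

Declare Scope heap_scope.
Delimit Scope heap_scope with heap.

(* Carriers are arbitrary types: no decidable equality or choice operator is
   assumed, so the multiplicative structures of MathComp, all of which extend
   choiceType, are not used for the product of a truss. *)
HB.mixin Record isHeap (H : Type) := {
  heap_nonempty : inhabited H;
  bracket : H -> H -> H -> H;
  bracketA : forall v w x y z : H,
    bracket v w (bracket x y z) = bracket (bracket v w x) y z;
  bracketKl : forall x y : H, bracket x x y = y;
  bracketKr : forall x y : H, bracket y x x = y
}.

#[short(type="heapType")]
HB.structure Definition Heap := { H of isHeap H }.

Notation "{[ x , y , z ]}" := (bracket x y z)
  (at level 0, x, y, z at level 99, format "{[ x ,  y ,  z ]}") : heap_scope.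
Local Open Scope heap_scope.

HB.mixin Record Heap_isAbelian H of Heap H := {
  bracketC : forall x y z : H, {[x, y, z]} = {[z, y, x]}
}.

#[short(type="abHeapType")]
HB.structure Definition AbelianHeap := { H of Heap_isAbelian H & Heap H }.

HB.mixin Record AbelianHeap_isTruss T of AbelianHeap T := {
  tmul : T -> T -> T;
  tmulA : associative tmul;
  tmul_bracketr : forall w x y z : T,
    tmul w {[x, y, z]} = {[tmul w x, tmul w y, tmul w z]};
  tmul_bracketl : forall x y z w : T,
    tmul {[x, y, z]} w = {[tmul x w, tmul y w, tmul z w]}
}.

#[short(type="trussType")]
HB.structure Definition Truss := { T of AbelianHeap_isTruss T & AbelianHeap T }.

Definition heap_morphism (H K : heapType) (f : H -> K) : Prop :=
  forall x y z : H, f {[x, y, z]} = {[f x, f y, f z]}.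

(* A predicate on the action rather than a structure on the carrier, since the
   same heap is considered with several actions. *)
Record is_left_module (T : trussType) (M : abHeapType) (act : T -> M -> M) :
    Prop := IsLeftModule {
  act_mul : forall (x y : T) (m : M), act (tmul x y) m = act x (act y m);
  act_bracketr : forall (x : T) (m m' m'' : M),
    act x {[m, m', m'']} = {[act x m, act x m', act x m'']};
  act_bracketl : forall (x y z : T) (m : M),
    act {[x, y, z]} m = {[act x m, act y m, act z m]}
}.

Definition module_morphism (T : trussType) (M N : abHeapType)
    (actM : T -> M -> M) (actN : T -> N -> N) (f : M -> N) : Prop :=
  heap_morphism f /\ forall (x : T) (m : M), f (actM x m) = actN x (f m).

Definition isomorphic_modules (T : trussType) (M N : abHeapType)
    (actM : T -> M -> M) (actN : T -> N -> N) : Prop :=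
  exists f : M -> N, module_morphism actM actN f /\ bijective f.

Definition is_absorber (T : trussType) (M : abHeapType) (act : T -> M -> M)
    (a : M) : Prop :=
  forall x : T, act x a = a.

Definition induced_action (T : trussType) (M : abHeapType) (act : T -> M -> M)
    (e : M) (x : T) (m : M) : M :=
  {[e, act x e, act x m]}.

(* Main.v *)
(** The translation [m |-> [e, x |> e, m]] is a heap morphism sending [x |> e]
    to [e], and [x |>^e -] is [x |> -] followed by it. Likewise the translation
    [m |-> [f, e, m]], with inverse [m |-> [e, f, m]], intertwines [|>^e] and
    [|>^f]. Linearity of [|>^e] in the truss argument mixes brackets of different
    elements and rests on the medial law of Abelian heaps. *)
Require Import Defs.
From HB Require Import structures.
From mathcomp Require Import all_boot.

Set Implicit Arguments.
Unset Strict Implicit.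
Unset Printing Implicit Defensive.

Local Open Scope heap_scope.

Lemma bracket_telescope (H : heapType) (x y z w : H) :
  {[x, y, {[y, z, w]}]} = {[x, z, w]}.
Proof. by rewrite bracketA bracketKr. Qed.

Lemma bracket_middle (H : heapType) (x a b c y : H) :
  {[x, {[a, b, c]}, y]} = {[{[x, c, b]}, a, y]}.
Proof.
(* Writing [y] as [[p, p, y]] with [p = [a, b, c]] leaves only [[[x, c, b], a, p] = x]. *)
rewrite -[in RHS](bracketKl {[a, b, c]} y) [RHS]bracketA.
by rewrite bracket_telescope -(bracketA x) bracketKl bracketKr.
Qed.

Lemma translation_morphism (H : heapType) (a b : H) :
  heap_morphism (fun m : H => {[a, b, m]}).
Proof.
by move=> x y z; rewrite bracket_middle bracket_telescope -bracketA bracketKl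
  bracketA.
Qed.

Lemma translationK (H : heapType) (a b : H) :
  cancel (fun m : H => {[a, b, m]}) (fun m : H => {[b, a, m]}).
Proof. by move=> m; rewrite bracket_telescope bracketKl. Qed.

Lemma bracket_swap_pos (H : abHeapType) (a b c d x : H) :
  {[{[a, b, c]}, d, x]} = {[{[a, b, x]}, d, c]}.
Proof. by rewrite -!bracketA (bracketC c). Qed.

Lemma bracket_swap_neg (H : abHeapType) (a b c d x : H) :
  {[{[a, b, c]}, d, x]} = {[{[a, d, c]}, b, x]}.
Proof. by rewrite -!bracket_middle bracketC (bracketC d) bracketC. Qed.

(** The medial law with first row [e = [e, e, e]]: in additive notation both sides are
    [e - a + b - c + a' - b' + c']. *)
Lemma bracket_translations (H : abHeapType) (e a b c a' b' c' : H) :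
  {[e, {[a, b, c]}, {[a', b', c']}]} =
  {[{[e, a, a']}, {[e, b, b']}, {[e, c, c']}]}.
Proof.
rewrite !bracket_middle bracket_telescope bracketA (bracket_swap_pos _ _ b).
by rewrite (bracket_swap_neg e c) (bracket_swap_neg _ c).
Qed.

Section InducedAction.
Variables (T : trussType) (M : abHeapType) (act : T -> M -> M).
Hypothesis Mmod : is_left_module act.

Lemma induced_action_left_module (e : M) :
  is_left_module (induced_action act e).
Proof.
split=> [x y m | x m m' m'' | x y z m]; rewrite /induced_action.
(* The outer [x |> e] cancels against the one produced by [x |> [e, y |> e, y |> m]]. *)
- by rewrite !(act_mul Mmod) (act_bracketr Mmod) bracket_telescope.
- by rewrite (act_bracketr Mmod) translation_morphism.
- by rewrite !(act_bracketl Mmod) bracket_translations.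
Qed.

Lemma translation_induced_action (e f : M) :
  module_morphism (induced_action act e) (induced_action act f)
    (fun m : M => {[f, e, m]}).
Proof.
split=> [|x m]; first exact: translation_morphism.
(* Both sides collapse to [[f, x |> e, x |> m]]: [e] cancels on the left, [x |> f] on the right. *)
by rewrite /induced_action (act_bracketr Mmod) !bracket_telescope.
Qed.

End InducedAction.

Theorem proposition4p28 (T : trussType) (M : abHeapType) (act : T -> M -> M)
    (Mmod : is_left_module act) :
  (forall e : M,
     (forall (x : T) (m : M),
        {[e, act x e, act x m]} = {[act x m, act x e, e]})
     /\ is_left_module (induced_action act e))
  /\ (forall e f : M,
        isomorphic_modules (induced_action act e) (induced_action act f))
  /\ (forall e : M, is_absorber (induced_action act e) e).
Proof.
split=> [e|]; last split=> [e f | e x].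
- split=> [x m|]; first exact: bracketC.
  exact: induced_action_left_module.
- exists (fun m : M => {[f, e, m]}); split.
    exact: translation_induced_action.
  by exists (fun m : M => {[e, f, m]}); apply: translationK.
- exact: bracketKr.
Qed.
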